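(* Let $p$ be an odd prime and $n=3p$. The set $\mathcal{C}_1=\{T_{a,b}:(a,b)\in A\}$ of Hamiltonian paths defined in the context is an $\left(n,\frac{(n-3)(n-9)}{9},n-4\right)$ tree-code; that is, $|\mathcal{C}_1|=\frac{(n-3)(n-9)}{9}$ and any two distinct elements of $\mathcal{C}_1$ have tree-distance at least $n-4$.
   Context: For spanning trees $T_1=(V,E_1)$, $T_2=(V,E_2)$ on a common labelled vertex set $V$ with $|V|=n$, the tree-distance is $n-1-|E_1\cap E_2|$. An $(n,M,d)$ tree-code is a set of $M$ spanning trees of the complete graph on $n$ labelled vertices with pairwise tree-distance at least $d$. Construction: Let $\mathbb{F}_p$ be the field of $p$ elements, $V_i=\{(i,j):j\in\mathbb{F}_p\}$ for $i=1,2,3$, and $V=V_1\cup V_2\cup V_3$. Let $A=\{(a,b)\in(\mathbb{F}_p\setminus\{0\})^2: a+b\ne0\text{ and }a-b\neq0\}$. For each $(a,b)\in A$, let $T_{a,b}$ be the Hamiltonian path on $V$ that visits vertices in the order $$(1,0),(2,a\cdot0+b),(3,b\cdot0+a),(1,1),(2,a\cdot1+b),(3,b\cdot1+a),\dots,(1,j),(2,aj+b),(3,bj+a),\dots,(1,p-1),(2,a(p-1)+b),(3,b(p-1)+a),$$ consecutive vertices being joined by an edge. *)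

(* Defs.v *)
From mathcomp Require Import all_boot all_order all_algebra.
Set Implicit Arguments.
Unset Strict Implicit.
Unset Printing Implicit Defensive.
Import GRing.Theory.
Local Open Scope nat_scope.

(* A graph on the labelled vertex set V is represented by its edge set, a set  *)
(* of two-element subsets of V.                                                *)

Definition simple_graph (V : finType) (E : {set {set V}}) : Prop :=
  forall e : {set V}, e \in E -> #|e| = 2.

Definition adjacent (V : finType) (E : {set {set V}}) : rel V :=
  fun x y => [set x; y] \in E.

Definition connected_graph (V : finType) (E : {set {set V}}) : Prop :=
  forall x y : V, connect (adjacent E) x y.

(* The bound on the length excludes the closed walks x, y that use the edge    *)
(* {x, y} twice.                                                               *)
Definition acyclic_graph (V : finType) (E : {set {set V}}) : Prop :=
  forall c : seq V, 2 < size c -> ~ ucycle (adjacent E) c.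

Definition spanning_tree (V : finType) (E : {set {set V}}) : Prop :=
  [/\ simple_graph E, connected_graph E & acyclic_graph E].

(* The subtraction is never truncated on spanning trees, which have            *)
(* #|V| - 1 edges.                                                             *)
Definition tree_distance (V : finType) (E1 E2 : {set {set V}}) : nat :=
  #|V| - 1 - #|E1 :&: E2|.

Definition tree_code (V : finType) (n M d : nat) (C : {set {set {set V}}}) : Prop :=
  [/\ #|V| = n,
      #|C| = M,
      forall E, E \in C -> spanning_tree E
    & forall E1 E2, E1 \in C -> E2 \in C -> E1 != E2 -> d <= tree_distance E1 E2].

Definition consecutive_edges (V : finType) (s : seq V) : {set {set V}} :=
  [set [set e.1; e.2] | e in zip s (behead s)].

Definition hamiltonian_path (V : finType) (E : {set {set V}}) : Prop :=
  exists s : seq V, [/\ uniq s, forall x, x \in s & E = consecutive_edges s].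

(* The classes V_1, V_2, V_3 are indexed by 0, 1, 2 in 'I_3.                   *)
Definition vertex (p : nat) : finType := ('I_3 * 'F_p)%type.

Definition vertex1 (p : nat) (j : 'F_p) : vertex p := (@Ordinal 3 0 isT, j).
Definition vertex2 (p : nat) (j : 'F_p) : vertex p := (@Ordinal 3 1 isT, j).
Definition vertex3 (p : nat) (j : 'F_p) : vertex p := (@Ordinal 3 2 isT, j).

Definition visit_order (p : nat) (a b : 'F_p) : seq (vertex p) :=
  flatten [seq (let j : 'F_p := (k%:R)%R in
                [:: vertex1 j; vertex2 (a * j + b)%R; vertex3 (b * j + a)%R])
          | k <- iota 0 p].

Definition path_tree (p : nat) (a b : 'F_p) : {set {set vertex p}} :=
  consecutive_edges (visit_order a b).

Definition parameter_set (p : nat) : {set 'F_p * 'F_p} :=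
  [set ab : 'F_p * 'F_p | [&& ab.1 != 0, ab.2 != 0, ab.1 + ab.2 != 0
                            & ab.1 - ab.2 != 0]%R].

Definition code1 (p : nat) : {set {set {set vertex p}}} :=
  [set path_tree ab.1 ab.2 | ab in parameter_set p].

(* Main.v *)
Require Import Defs.
From mathcomp Require Import all_boot all_order all_algebra.
From mathcomp Require Import zify ring.

(** Number the classes of vertices by 'I_3, with addition modulo 3.  Every edge
    of a code tree joins the two classes other than some class [i], hence is
    [cross_edge i x y], the points of the classes [i + 1] and [i + 2] with
    coordinates [x] and [y].  For fixed [i] and fixed parameters [(a, b)], the
    pairs [(x, y)] that occur lie on one line of the affine plane over 'F_p
    ([path_tree_on_line]):
      - [y = a x + b] between the classes 0 and 1,
      - [b x - a y = b^2 - a^2] between the classes 1 and 2,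
      - [x = b (y - 1) + a] between the classes 2 and 0.
    Distinct parameters in A give distinct lines.  This is clear for the first
    and third families.  In the second one, if [(a, b)] and [(a', b')] give the
    same line then [(a', b') = t (a, b)] for some nonzero scalar [t], so that
    [t (b^2 - a^2) = b'^2 - a'^2 = t^2 (b^2 - a^2)]; the conditions
    [a + b != 0] and [a - b != 0] then force [t = 1].  Two distinct lines meet
    at most once ([on_line_meet]), so two code trees share at most one edge for
    each [i], at most three in all ([card_path_tree_common]), and their distance
    is at least [n - 1 - 3].

    The edges between the classes 0 and 1 determine the map [x |-> a x + b], and
    so the parameters ([path_tree_inj]).  Hence the size of the code is that of
    A, namely [(p - 1) (p - 3)]: for each nonzero [a] the values 0, [a], [-a]
    excluded for [b] are distinct because [p] is odd.

    Since [a] and [b] are nonzero, the maps [j |-> a j + b] and [j |-> b j + a]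
    are onto, so each sequence visits every vertex; having length [3 p], it does
    so exactly once ([visit_order_uniq]).  A Hamiltonian path is a spanning tree
    ([hamiltonian_path_spanning_tree]). *)

Set Implicit Arguments.
Unset Strict Implicit.
Unset Printing Implicit Defensive.
Import GRing.Theory.

(** * Hamiltonian paths are spanning trees *)

Section HamiltonianPath.
Variable V : finType.
Implicit Types (s : seq V) (x y : V).

(** The position in the sequence serves as a height function on the path: it
    shows that the edges have two distinct ends and that there are no cycles. *)
Lemma index_zip_behead s x y :
  uniq s -> (x, y) \in zip s (behead s) ->
  [/\ x \in s, y \in s & index y s = (index x s).+1].
Proof.
case: s => // u s; elim: s u => [|v s IHs] u //= /andP[uNvs uniq_vs].
rewrite inE => /predU1P[[-> ->]|/(IHs v uniq_vs)[x_in y_in ixy]].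
  rewrite !inE !eqxx orbT /=; split=> //.
  by case: eqP uNvs => // ->; rewrite inE eqxx.
rewrite ![_ \in u :: _]inE x_in y_in !orbT; split=> //.
have neq z : z \in v :: s -> (u == z) = false.
  by move=> z_in; apply: contraNF uNvs => /eqP->.
rewrite (neq x x_in) (neq y y_in) /= in ixy *.
by rewrite ixy.
Qed.

Lemma adjacent_index s x y :
  uniq s -> adjacent (consecutive_edges s) x y ->
  [/\ x \in s, y \in s
    & index y s = (index x s).+1 \/ index x s = (index y s).+1].
Proof.
move=> uniq_s /imsetP[[u v] /(index_zip_behead uniq_s)[u_in v_in iuv]] /= xy_uv.
have: u \in [set x; y] by rewrite xy_uv set21.
have: v \in [set x; y] by rewrite xy_uv set22.
have: x \in [set u; v] by rewrite -xy_uv set21.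
have: y \in [set u; v] by rewrite -xy_uv set22.
have neq_uv : u <> v by move=> eq_uv; rewrite eq_uv in iuv; lia.
rewrite !inE => /pred2P[] -> /pred2P[] -> /pred2P[] e1 /pred2P[] e2; subst=> //.
- by split=> //; right.
- by split=> //; left.
Qed.

Lemma consecutive_edges_path x s :
  path (adjacent (consecutive_edges (x :: s))) x s.
Proof.
(* The edge set is generalized because it shrinks when the head is removed. *)
suff sub (E : {set {set V}}) t u : consecutive_edges (u :: t) \subset E ->
  path (adjacent E) u t by apply: sub.
elim: t u => //= v t IHt u /subsetP subE; apply/andP; split.
  by apply: subE; apply/imsetP; exists (u, v); rewrite //= mem_head.
apply: IHt; apply/subsetP => _ /imsetP[f f_in ->].
by apply: subE; apply/imsetP; exists f; rewrite //= inE f_in orbT.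
Qed.

(** Positions along the path change by one across an edge.  On a cycle, both
    neighbours of the vertex of largest position would therefore sit at the
    position just before it, hence coincide. *)
Lemma hamiltonian_path_acyclic s :
  uniq s -> acyclic_graph (consecutive_edges s).
Proof.
move=> uniq_s c c_gt2 /andP[cyc_c uniq_c].
have [x x_in x_max] : exists2 x, x \in c &
    forall y, y \in c -> index y s <= index x s.
  case: c c_gt2 {cyc_c uniq_c} => // u c _.
  by case: (arg_maxnP (fun v => index v s) (mem_head u c)) => x; exists x.
have [i c' rot_c] := rot_to x_in.
have mem_c : c =i x :: c' by move=> z; rewrite -rot_c mem_rot.
rewrite -(size_rot i) rot_c in c_gt2.
rewrite -(rot_uniq i) rot_c in uniq_c.
rewrite -(rot_cycle i) rot_c in cyc_c.
(* The cycle is now [x :: y :: rcons c' z], with [x] of largest position. *)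
case: c' => [|y c'] in rot_c mem_c c_gt2 cyc_c uniq_c *; first by [].
case/lastP: c' => [|c' z] in rot_c mem_c c_gt2 cyc_c uniq_c *; first by [].
move: cyc_c => /=; rewrite rcons_path last_rcons.
case/and3P=> xy _ zx.
have [_ y_in ixy] := adjacent_index uniq_s xy.
have [z_in _ izx] := adjacent_index uniq_s zx.
have y_le : index y s <= index x s by apply: x_max; rewrite mem_c !inE eqxx orbT.
have z_le : index z s <= index x s.
  by apply: x_max; rewrite mem_c !inE mem_rcons mem_head !orbT.
have eq_yz : y = z.
  by rewrite -(nth_index x y_in) -(nth_index x z_in); congr nth; lia.
by move: uniq_c => /=; rewrite mem_rcons eq_yz mem_head andbF.
Qed.

Lemma hamiltonian_path_spanning_tree (E : {set {set V}}) :
  hamiltonian_path E -> spanning_tree E.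
Proof.
case=> s [uniq_s all_s ->]; split; last exact: hamiltonian_path_acyclic.
  move=> _ /imsetP[[u v] /(index_zip_behead uniq_s)[_ _ iuv] ->] /=.
  by rewrite cards2; case: eqP => // eq_uv; rewrite eq_uv in iuv; lia.
move=> x y; set E' := consecutive_edges s.
have adj_sym : connect_sym (adjacent E').
  by apply: sym_connect_sym => u v; rewrite /adjacent setUC.
case: s => [|u s] in uniq_s all_s E' adj_sym *; first by have := all_s x.
have conn z : connect (adjacent E') u z.
  by apply: (path_connect (consecutive_edges_path u s)); apply: all_s.
by apply: connect_trans (conn y); rewrite adj_sym.
Qed.

End HamiltonianPath.

(** * The edges of a path through triples *)

Section Triples.
Variables (T : eqType) (f g h : nat -> T).
Let triples m q := flatten [seq [:: f k; g k; h k] | k <- iota m q].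

(** The third alternative leaves [k] unbounded, so it also admits the pair that
    would close the path up; an over-approximation of the edges is enough to
    bound the intersection of two edge sets. *)
Lemma zip_triplesP m q e :
  e \in zip (triples m q) (behead (triples m q)) ->
  exists k, [\/ e = (f k, g k), e = (g k, h k) | e = (h k, f k.+1)].
Proof.
elim: q m => //= q IHq m; rewrite !inE.
case/or3P=> [/eqP->|/eqP->|].
- by exists m; constructor 1.
- by exists m; constructor 2.
case: q IHq => //= q IHq; rewrite in_cons => /predU1P[->|/(IHq m.+1)//].
by exists m; constructor 3.
Qed.

Lemma mem_zip_triples m q k :
  m <= k < m + q -> (f k, g k) \in zip (triples m q) (behead (triples m q)).
Proof.
elim: q m => [|q IHq] m; first by lia.
rewrite /= !inE; have [->|neq_mk] := eqVneq m k; first by rewrite eqxx.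
case: q IHq => [|q] IHq bnd; first by lia.
by rewrite [X in _ || (_ || X)]in_cons [X in _ || (_ || (_ || X))]IHq ?orbT //; lia.
Qed.

End Triples.

(** * The code trees as families of lines *)

Section CodeTrees.
Variables (p : nat) (p_prime : prime p) (p_odd : odd p).
Local Open Scope ring_scope.
Implicit Types (a b x y : 'F_p) (i : 'I_3).

Lemma natr_Fp x : exists2 k, (k < p)%N & x = k%:R.
Proof.
exists (val x); last by rewrite natr_Zp.
by rewrite -[X in (_ < X)%N](Fp_cast p_prime) ltn_ord.
Qed.

Lemma mem_visit_order a b (v : vertex p) :
  a != 0 -> b != 0 -> v \in visit_order a b.
Proof.
move=> a0 b0; have mem_block k u : (k < p)%N ->
    u \in [:: vertex1 k%:R; vertex2 (a * k%:R + b); vertex3 (b * k%:R + a)] ->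
    u \in visit_order a b.
  by move=> ltkp u_in; apply/flatten_mapP; exists k; rewrite ?mem_iota.
case: v => i x.
have [k1 lt1 e1] := natr_Fp x.
have [k2 lt2 e2] := natr_Fp ((x - b) / a).
have [k3 lt3 e3] := natr_Fp ((x - a) / b).
case: i => [[|[|[|//]]] lti]; rewrite (bool_irrelevance lti isT).
- by apply: (mem_block k1 _ lt1); rewrite -e1 mem_head.
- apply: (mem_block k2 _ lt2); rewrite -e2 (mulrC a) divfK // subrK.
  by rewrite inE mem_head orbT.
- apply: (mem_block k3 _ lt3); rewrite -e3 (mulrC b) divfK // subrK.
  by rewrite 2!inE mem_head !orbT.
Qed.

Lemma card_vertex : #|vertex p| = (3 * p)%N.
Proof. by rewrite card_prod card_ord card_Fp. Qed.

(** The sequence meets all [3 p] vertices and has length [3 p]. *)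
Lemma visit_order_uniq a b : a != 0 -> b != 0 -> uniq (visit_order a b).
Proof.
move=> a0 b0; apply: (leq_size_uniq (enum_uniq (vertex p))).
  by move=> v _; apply: mem_visit_order.
rewrite -cardE card_vertex size_flatten /shape -map_comp.
by rewrite sumnE big_map /= big_const_seq count_predT size_iota iter_addn_0.
Qed.

(** Indexing by the class [i] that the edge avoids treats the three kinds of
    edges uniformly: [i + 1] and [i + 2] are taken modulo 3. *)
Definition cross_edge i x y : {set vertex p} := [set (i + 1, x); (i + 2, y)].

(** The equations satisfied by the coordinates of the edges that avoid the class
    [i]; the last case is [i = 2]. *)
Definition on_line i a b x y : Prop :=
  match val i with
  | 0 => b * x - a * y = b ^+ 2 - a ^+ 2
  | 1 => x = b * (y - 1) + a
  | _ => y = a * x + b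
  end.

Lemma path_tree_on_line a b e : e \in path_tree a b ->
  exists i x y, e = cross_edge i x y /\ on_line i a b x y.
Proof.
case/imsetP=> uv /zip_triplesP[k uv_k] ->.
case: uv_k => -> /=.
- exists (@Ordinal 3 2 isT), k%:R, (a * k%:R + b); split=> //.
  by congr [set (_, _); (_, _)]; apply: val_inj.
- exists (@Ordinal 3 0 isT), (a * k%:R + b), (b * k%:R + a); split.
    by congr [set (_, _); (_, _)]; apply: val_inj.
  by rewrite /on_line /=; ring.
- exists (@Ordinal 3 1 isT), (b * k%:R + a), (k.+1%:R); split.
    by congr [set (_, _); (_, _)]; apply: val_inj.
  by rewrite /on_line /=; ring.
Qed.

Lemma cross_edge_classes i x y : [set v.1 | v in cross_edge i x y] = ~: [set i].
Proof.
rewrite imsetU !imset_set1 /=.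
by apply/setP=> j; rewrite !inE; case: i j => [[|[|[|?]]] ?] [[|[|[|?]]] ?].
Qed.

Lemma cross_edge_inj i i' x y x' y' :
  cross_edge i x y = cross_edge i' x' y' -> [/\ i = i', x = x' & y = y'].
Proof.
move=> eq_e; have eq_i : i = i'.
  apply/set1_inj/setC_inj.
  by rewrite -(cross_edge_classes i x y) -(cross_edge_classes i' x' y') eq_e.
subst i'; have neq_i : (i + 1 == i + 2) = false by rewrite (inj_eq (addrI i)).
have: (i + 1, x) \in cross_edge i x' y' by rewrite -eq_e set21.
have: (i + 2, y) \in cross_edge i x' y' by rewrite -eq_e set22.
rewrite !inE !xpair_eqE !eqxx neq_i eq_sym neq_i /= orbF.
by move=> /eqP-> /eqP->.
Qed.

(** Each family consists of distinct lines, and distinct lines share at most one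
    point.  In the case [i = 0], two common points make the direction vectors
    [(a, b)] and [(a', b')] proportional; comparing the constant terms
    [b^2 - a^2] and [b'^2 - a'^2] with this factor gives
    [a' (b^2 - a^2) (a' - a) = 0], where only the last factor can vanish. *)
Lemma on_line_meet i a b a' b' x y x' y' :
  (a, b) \in parameter_set p -> (a', b') \in parameter_set p ->
  (a, b) != (a', b') ->
  on_line i a b x y -> on_line i a' b' x y ->
  on_line i a b x' y' -> on_line i a' b' x' y' -> x = x' /\ y = y'.
Proof.
rewrite !inE /= => /and4P[a0 b0 sab dab] /and4P[a'0 b'0 _ _] neq.
have solve (u v : 'F_p) : u * v = 0 -> u != 0 -> v = 0.
  by move=> /eqP; rewrite mulf_eq0 => /orP[->|/eqP].
rewrite /on_line; case: (val i) => [|[|_]].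
- move=> L1 L2 L3 L4.
  (* As [a != 0], a point of the first line is determined by its abscissa. *)
  have [exx|nxx] := eqVneq (x - x') 0.
    split; first by apply/eqP; rewrite -subr_eq0 exx.
    apply/eqP; rewrite -subr_eq0; apply/eqP/(solve a) => //.
    have ->: a * (y - y') = b * (x - x') - (b * x - a * y) + (b * x' - a * y')
      by ring.
    by rewrite L1 L3 exx; ring.
  have par : a * b' - a' * b = 0.
    apply: (solve (x - x')) => //.
    have -> : (x - x') * (a * b' - a' * b) =
      a * ((b' * x - a' * y) - (b' * x' - a' * y'))
      - a' * ((b * x - a * y) - (b * x' - a * y')) by ring.
    by rewrite L1 L2 L3 L4; ring.
  have eq_a : a' - a = 0.
    apply: (solve (a' * ((a + b) * (a - b)))); last by rewrite !mulf_neq0.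
    have -> : a' * ((a + b) * (a - b)) * (a' - a) =
      - (a * (a * (b' ^+ 2 - a' ^+ 2) - a' * (b ^+ 2 - a ^+ 2)))
      + (a * b' - a' * b) * (a * b' + a' * b) by ring.
    rewrite -L1 -L2.
    have -> : a * (b' * x - a' * y) - a' * (b * x - a * y) =
      (a * b' - a' * b) * x by ring.
    by rewrite par; ring.
  move/eqP: eq_a; rewrite subr_eq0 => /eqP eq_a; subst a'.
  case/eqP: neq; congr (_, _); apply/esym/eqP; rewrite -subr_eq0.
  by apply/eqP/(solve a) => //; rewrite -par; ring.
- move=> L1 L2 L3 L4.
  have nb : b - b' != 0.
    apply: contra neq; rewrite subr_eq0 => /eqP eq_b; subst b'.
    by move: L1; rewrite L2 => /addrI->.
  have eq_y : y = y'.
    apply/eqP; rewrite -subr_eq0; apply/eqP/(solve (b - b')) => //.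
    have -> : (b - b') * (y - y') =
      ((b * (y - 1) + a) - (b' * (y - 1) + a'))
      - ((b * (y' - 1) + a) - (b' * (y' - 1) + a')) by ring.
    by rewrite -L1 -L2 -L3 -L4 !subrr.
  by rewrite L1 L3 eq_y.
- move=> L1 L2 L3 L4.
  have na : a - a' != 0.
    apply: contra neq; rewrite subr_eq0 => /eqP eq_a; subst a'.
    by move: L1; rewrite L2 => /addrI->.
  have eq_x : x = x'.
    apply/eqP; rewrite -subr_eq0; apply/eqP/(solve (a - a')) => //.
    have -> : (a - a') * (x - x') =
      ((a * x + b) - (a' * x + b')) - ((a * x' + b) - (a' * x' + b')) by ring.
    by rewrite -L1 -L2 -L3 -L4 !subrr.
  by rewrite L1 L3 eq_x.
Qed.

Lemma path_tree_common_on_line a b a' b' e :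
  e \in path_tree a b :&: path_tree a' b' ->
  exists i x y,
    [/\ e = cross_edge i x y, on_line i a b x y & on_line i a' b' x y].
Proof.
case/setIP=> /path_tree_on_line[i [x [y [-> L]]]].
case/path_tree_on_line=> [i' [x' [y' [/cross_edge_inj[<- <- <-] L']]]].
by exists i, x, y.
Qed.

(** Mapping a common edge to the set of classes that it meets is injective by
    [on_line_meet], and takes at most three values. *)
Lemma card_path_tree_common a b a' b' :
  (a, b) \in parameter_set p -> (a', b') \in parameter_set p ->
  (a, b) != (a', b') ->
  (#|path_tree a b :&: path_tree a' b'| <= 3)%N.
Proof.
move=> ab_in ab'_in neq.
set common := _ :&: _; pose classes (e : {set vertex p}) := [set v.1 | v in e].
rewrite -(card_in_imset (_ : {in common &, injective classes})); last first.
  move=> _ _ /path_tree_common_on_line[i [x [y [-> L1 L2]]]]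
             /path_tree_common_on_line[i' [x' [y' [-> L3 L4]]]].
  rewrite /classes !cross_edge_classes => /setC_inj/set1_inj eq_i; subst i'.
  by have [-> ->] := on_line_meet ab_in ab'_in neq L1 L2 L3 L4.
have sub : classes @: common \subset [set ~: [set i] | i : 'I_3].
  apply/subsetP=> _ /imsetP[_ /path_tree_common_on_line[i [x [y [-> _ _]]]] ->].
  by rewrite /classes cross_edge_classes; apply/imsetP; exists i.
apply: leq_trans (subset_leq_card sub) _.
by apply: leq_trans (leq_imset_card _ _) _; rewrite card_ord.
Qed.

Lemma path_tree_first_edge a b k :
  (k < p)%N -> cross_edge 2 k%:R (a * k%:R + b) \in path_tree a b.
Proof.
move=> ltkp; pose f k : vertex p := vertex1 (k%:R : 'F_p).
pose g k : vertex p := vertex2 (a * k%:R + b).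
pose h k : vertex p := vertex3 (b * k%:R + a).
apply/imsetP; exists (f k, g k).
  by apply: (mem_zip_triples f g h); rewrite add0n.
by congr [set (_, _); (_, _)]; apply: val_inj.
Qed.

(** Already the edges at [x = 0] and [x = 1] between the classes 0 and 1
    determine the affine map [x |-> a x + b]. *)
Lemma path_tree_inj a b a' b' :
  path_tree a b = path_tree a' b' -> (a, b) = (a', b').
Proof.
move=> eq_T.
have val_eq k : (k < p)%N -> a * k%:R + b = a' * k%:R + b'.
  move=> ltkp; have := path_tree_first_edge a b ltkp; rewrite eq_T.
  by case/path_tree_on_line=> i [x [y [/cross_edge_inj[<- <- <-]]]].
have eq_b : b = b'.
  by have := val_eq 0 (prime_gt0 p_prime); rewrite !mulr0 !add0r.
by have := val_eq 1 (prime_gt1 p_prime); rewrite !mulr1 eq_b => /addIr->.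
Qed.

Lemma Fp_neq_opp a : a != 0 -> a != - a.
Proof.
move=> a0; rewrite -subr_eq0 opprK -mulr2n -mulr_natl mulf_neq0 //.
rewrite -(dvdn_pcharf (pchar_Fp p_prime)).
by rewrite dvdn_prime2 //; apply: contraL p_odd => /eqP->.
Qed.

Lemma card_parameter_set : #|parameter_set p| = ((p - 1) * (p - 3))%N.
Proof.
pose P a := a != 0; pose Q a b := b \in ~: [set 0; a; - a].
have in_par ab : (ab \in parameter_set p) = P ab.1 && Q ab.1 ab.2.
  case: ab => a b; rewrite !inE /P /Q /= !inE !negb_or.
  rewrite subr_eq0 addrC addr_eq0 (eq_sym a b).
  by case: (a == 0); case: (b == 0); case: (b == a); case: (b == - a).
rewrite -sum1_card (eq_bigl _ _ in_par) -(pair_big_dep P Q (fun _ _ => 1%N)) /=.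
have inner a : P a -> (\sum_(b | Q a b) 1 = p - 3)%N.
  rewrite /P => a0; rewrite sum1_card.
  have card3 : #|[set 0; a; - a]| = 3%N.
    rewrite setUC cardsU1 cards2 !inE negb_or oppr_eq0 a0.
    by rewrite (eq_sym (- a)) Fp_neq_opp // eq_sym a0.
  have := cardsC [set 0; a; - a]; rewrite card3 card_Fp // => card_p.
  by rewrite -[X in (X - 3)%N]card_p addKn; apply: eq_card.
rewrite (eq_bigr _ inner) sum_nat_const; congr (_ * _)%N.
by have := cardC1 (0 : 'F_p); rewrite card_Fp // -subn1 => <-; apply: eq_card.
Qed.

Lemma code1_hamiltonian_path T : T \in code1 p -> hamiltonian_path T.
Proof.
case/imsetP=> [[a b]]; rewrite inE /= => /and4P[a0 b0 _ _] ->.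
exists (visit_order a b); split=> //; first exact: visit_order_uniq.
by move=> v; apply: mem_visit_order.
Qed.

End CodeTrees.

Theorem mainTheorem5 (p n : nat) (hp : prime p) (hodd : odd p) (hn : n = 3 * p) :
  (forall T : {set {set vertex p}}, T \in code1 p -> hamiltonian_path T) /\
  tree_code n ((n - 3) * (n - 9) %/ 9) (n - 4) (code1 p).
Proof.
split; first exact: code1_hamiltonian_path.
split; first by rewrite card_vertex.
- rewrite card_imset; last by move=> [a b] [a' b'] /(path_tree_inj hp).
  rewrite card_parameter_set // hn.
  have -> : (3 * p - 3) * (3 * p - 9) = (p - 1) * (p - 3) * 9 by nia.
  by rewrite mulnK.
- by move=> T /(code1_hamiltonian_path hp)/hamiltonian_path_spanning_tree.
move=> _ _ /imsetP[[a b] ab_in ->] /imsetP[[a' b'] ab'_in ->] /= neq_T.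
have neq : (a, b) != (a', b') by apply: contraNneq neq_T => -[-> ->].
have := card_path_tree_common ab_in ab'_in neq.
by rewrite /tree_distance card_vertex // hn; lia.
Qed.
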